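(* Let $g:\mathbb{R}\to\mathbb{R}$ be a $T$-periodic $C^1$ function with only finitely many critical points in every bounded interval. Let $0<a<1$ and let $(a_n)_{n=0}^\infty$ be a sequence of independent random variables on a probability space $(\Omega,\mathbb{P})$, with $a_n$ uniformly distributed on $(-a^n,a^n)$. Let $(b_n)_{n=0}^\infty$ be a sequence for which there exists $b>1$ with $b_{n+1}/b_n\ge b$ for all $n>0$, and assume $a^2b>1$. Let $\theta_n\in\mathbb{R}$. Put $f(x)=\sum_{n=0}^\infty a_n g(b_n x+\theta_n)$. Then almost surely the occupation measure $\mu$ of $f$ is absolutely continuous with respect to Lebesgue measure, with a density in $L^2$. Moreover, if $b_n=b^n$ for an integer $b>1$ and $\theta_n=0$ for every $n$, then the same conclusion holds with the assumption $a^2b>1$ replaced by $ab>1$.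
   Context: The occupation measure of $f$ is the Borel measure on $\mathbb{R}$ given by $\mu(S)=\mathcal{L}(\{x\in J: f(x)\in S\})$, where $J=[0,T]$ and $\mathcal{L}$ is Lebesgue measure. A critical point of $g$ is a point where $g'$ vanishes. *)

(* Defs.v *)
From HB Require Import structures.
From mathcomp Require Import all_boot all_order all_algebra finmap.
From mathcomp Require Import all_classical all_reals all_analysis.
Set Implicit Arguments. Unset Strict Implicit. Unset Printing Implicit Defensive.
Import Order.TTheory GRing.Theory Num.Theory.
Import numFieldNormedType.Exports.
Local Open Scope classical_set_scope.
Local Open Scope ring_scope.

Section defs.
Context {R : realType}.

Definition C1 (g : R -> R) : Prop :=
  (forall x, derivable g x 1) /\ continuous (derive1 g).

Definition critical_points (g : R -> R) : set R := [set x | derive1 g x = 0].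

Definition locally_finitely_many_critical (g : R -> R) : Prop :=
  forall c d : R, finite_set (`[c, d] `&` critical_points g).

Definition mutually_independent {d} {Omega : measurableType d}
    (P : probability Omega R) (X : nat -> Omega -> R) : Prop :=
  forall (I : {fset nat}) (B : nat -> set R),
    (forall i, measurable (B i)) ->
    P (\bigcap_(i in [set` I]) (X i @^-1` B i)) =
    (\prod_(i <- I) P (X i @^-1` B i))%E.

Definition uniform_sym {d} {Omega : measurableType d}
    (P : probability Omega R) (X : Omega -> R) (c : R) : Prop :=
  forall B : set R, measurable B ->
    P (X @^-1` B) = (((2 * c)^-1)%:E * lebesgue_measure (B `&` [set x : R | (- c < x < c)%R]))%E.

Definition random_series {Omega : Type} (A : nat -> Omega -> R) (g : R -> R)
    (bn th : nat -> R) (w : Omega) : R -> R :=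
  fun x => limn (fun N => \sum_(0 <= n < N) A n w * g (bn n * x + th n)).

Definition occupation (f : R -> R) (T : R) (S : set R) : \bar R :=
  lebesgue_measure (`[0, T] `&` f @^-1` S).

Definition abs_continuous (mu : set R -> \bar R) : Prop :=
  forall S : set R, measurable S -> lebesgue_measure S = 0%E -> mu S = 0%E.

Definition has_L2_density (mu : set R -> \bar R) : Prop :=
  exists h : R -> R,
    [/\ measurable_fun setT h, (forall x, 0 <= h x),
        (\int[lebesgue_measure]_x ((h x) ^+ 2)%:E < +oo)%E &
        forall S : set R, measurable S ->
          mu S = (\int[lebesgue_measure]_(x in S) (h x)%:E)%E].

End defs.

(* Main.v *)
Require Import Defs.
From HB Require Import structures.
From mathcomp Require Import all_boot all_order all_algebra finmap.
From mathcomp Require Import all_classical all_reals all_analysis.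
From mathcomp Require Import measurable_realfun ring lra.
Set Implicit Arguments. Unset Strict Implicit. Unset Printing Implicit Defensive.
Import Order.TTheory GRing.Theory Num.Theory.
Import numFieldNormedType.Exports.
Local Open Scope classical_set_scope.
Local Open Scope ring_scope.

(* Averaging over the law of the coefficients, it suffices to bound by [C r]
   the expected measure of the pairs [(x, y)] with [|f x - f y| < r]: by Fatou
   almost every [f] then satisfies such a bound along a sequence [r_n -> 0],
   so the ball averages of its occupation measure are bounded in L^2, and they
   converge to the density by Lebesgue differentiation.

   Since [a_n] is uniform and independent of the other coefficients, [P (|f x
   - f y| < r) <= 2 r / (a^n |g (b_n x + th_n) - g (b_n y + th_n)|)] for every
   [n]. For fixed [x], the [y] such that the difference is below a small [eps]
   at the scales [n = 1, 1 + k, ..., 1 + (J - 1) k] are covered at scale [1 +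
   J k] by balls of total length [O ((2 M / b^k)^J)], where [M] counts the
   monotone pieces of [g]. Summing over the first scale at which the
   difference exceeds [eps] gives a geometric series of ratio [2 M / (a b)^k],
   which is below 1 for large [k] as soon as [a b > 1]. This last condition
   follows from [a^2 b > 1] and [a < 1], so both parts of the theorem are
   instances of the same statement. *)

(** * Limits inferior in the extended reals *)

Section limn_einf_lemmas.
Context {R : realType}.
Local Open Scope ereal_scope.

Lemma limn_einf_ge0 (u : (\bar R)^nat) : (forall n, 0 <= u n) -> 0 <= limn_einf u.
Proof.
move=> u0; rewrite limn_einf_lim; apply: lime_ge; first exact: is_cvg_einfs.
by near=> n; apply: le_ereal_inf_tmp => _ [m _ <-].
Unshelve. all: by end_near. Qed.

Lemma limn_einf_le_near (u : (\bar R)^nat) c :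
  (\forall n \near \oo, u n <= c) -> limn_einf u <= c.
Proof.
move=> uc; rewrite limn_einf_lim; apply: lime_le; first exact: is_cvg_einfs.
near=> n; apply: le_trans (_ : u n <= c); last by near: n.
by apply: ereal_inf_lbound; exists n => /=.
Unshelve. all: by end_near. Qed.

Lemma measurable_limn_einf d (Y : measurableType d) (D : set Y) (u : (Y -> \bar R)^nat) :
  (forall n, measurable_fun D (u n)) -> measurable_fun D (fun y => limn_einf (u ^~ y)).
Proof.
move=> mu; apply: measurableT_comp => //.
by apply: measurable_fun_limn_esup => n; exact: measurableT_comp.
Qed.

End limn_einf_lemmas.

(** * Square-integrable densities from the near-diagonal mass *)

Section ball_averages.
Context {R : realType}.
Local Notation leb := (@lebesgue_measure R).
Local Open Scope ereal_scope.

Definition near_diag (r : R) : set (measurableTypeR R * measurableTypeR R) :=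
  [set p | (`|p.1 - p.2| < r)%R].

Lemma measurable_near_diag r : measurable (near_diag r).
Proof.
have mf : measurable_fun setT
    (fun p : measurableTypeR R * measurableTypeR R => `|p.1 - p.2|%R).
  by apply: measurableT_comp => //; exact: measurable_funB.
rewrite -[near_diag r]setTI.
rewrite (_ : near_diag r = (fun p : measurableTypeR R * measurableTypeR R => `|p.1 - p.2|%R) @^-1` `]-oo, r[%classic).
  exact: mf.
by apply/seteqP; split => p /=; rewrite in_itv.
Qed.

Lemma xsection_near_diag r t : xsection (near_diag r) t = ball (t : R) r.
Proof. by rewrite xsectionE. Qed.

Lemma ysection_near_diag r t : ysection (near_diag r) t = ball (t : R) r.
Proof. by rewrite ysectionE /near_diag; apply/seteqP; split => x; rewrite /ball/= distrC. Qed.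

Variable mu : {finite_measure set (measurableTypeR R) -> \bar R}.

Lemma measurable_measure_ball r :
  measurable_fun setT (fun t : measurableTypeR R => mu (ball (t : R) r)).
Proof.
have := measurable_fun_xsection mu (measurable_near_diag r).
by apply: eq_measurable_fun => t _ /=; rewrite xsection_near_diag.
Qed.

(** Tonelli for [phi] times the indicator of the strip, whose sections in both directions are balls
    of radius [r]. *)
Lemma integral_near_diag r (phi : measurableTypeR R -> \bar R) :
  measurable_fun setT phi -> (forall t, 0 <= phi t) ->
  \int[leb]_t (phi t * mu (ball (t : R) r)) =
  \int[mu]_s \int[leb]_(t in ball (s : R) r) phi t.
Proof.
move=> mphi phi0.
pose F (p : measurableTypeR R * measurableTypeR R) := phi p.1 * (\1_(near_diag r) p)%:E.
have mF : measurable_fun setT F.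
  apply: emeasurable_funM; first exact: measurableT_comp.
  apply/measurable_EFinP; apply: measurable_indic; exact: measurable_near_diag.
have F0 p : 0 <= F p by rewrite mule_ge0// lee_fin.
have := @fubini_tonelli _ _ _ _ _ leb mu F mF F0.
rewrite (_ : (fun x => _) = (fun t => phi t * mu (ball (t : R) r))); last first.
  apply/funext => t; rewrite /F/= ge0_integralZl//.
  - congr (_ * _); rewrite -[X in _ = mu X]setIT -integral_indic //; last exact: measurable_ball.
  - rewrite (_ : (fun _ => _) = EFin \o \1_(ball (t : R) r)).
      apply/measurable_EFinP; apply: measurable_indic; exact: measurable_ball.
    by apply/funext => s /=; rewrite !indicE -mem_xsection xsection_near_diag.
move=> ->; apply: eq_integral => s _.
rewrite [RHS]integral_mkcond; apply: eq_integral => t _.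
rewrite /F/= patchE indicE -mem_ysection ysection_near_diag.
by case: ifP => _; rewrite ?mule1 ?mule0.
Qed.

(** Taking [phi] to be the ball mass itself, the inner integral runs over the [t] within [r] of [s],
    whose balls of radius [r] lie in the ball of radius [2 r] about [s]. *)
Lemma integral_sqr_measure_ball (r : R) : (0 < r)%R ->
  \int[leb]_t (mu (ball (t : R) r) * mu (ball (t : R) r)) <=
  (r *+ 2)%:E * \int[mu]_s mu (ball (s : R) (r *+ 2)%R).
Proof.
move=> r0; rewrite integral_near_diag //; last exact: measurable_measure_ball.
rewrite -ge0_integralZl //=; last 2 first.
  exact: measurable_measure_ball.
  by rewrite lee_fin mulrn_wge0// ltW.
have mball2 := measurable_measure_ball.
apply: ge0_le_integral => //.
- by move=> s _; exact: integral_ge0.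
- have := @measurable_fun_fubini_tonelli_G _ _ _ _ _ leb (fun p : measurableTypeR R * measurableTypeR R => mu (ball (p.1 : R) r) * (\1_(near_diag r) p)%:E).
  move=> H; apply: (eq_measurable_fun _ _ (H _ _)).
  + move=> s _; rewrite /fubini_G [RHS]integral_mkcond; apply: eq_integral => t _.
    rewrite /= patchE indicE -mem_ysection ysection_near_diag.
    by case: ifP => _; rewrite ?mule1 ?mule0.
  + apply: emeasurable_funM; first exact: measurableT_comp (mball2 r) _.
    apply/measurable_EFinP; apply: measurable_indic; exact: measurable_near_diag.
  + by move=> p; rewrite mule_ge0// lee_fin.
- exact: measurable_funeM.
- move=> s _.
  apply: (@le_trans _ _ (\int[leb]_(t in ball (s : R) r) (cst (mu (ball (s : R) (r *+ 2)%R)) t))).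
    apply: ge0_le_integral => //.
    + exact: measurable_ball.
    + exact: measurable_funTS.
    + move=> t st; apply: le_measure; rewrite ?inE; try exact: measurable_ball.
      move=> u tu; rewrite mulr2n; exact: ball_triangle st tu.
  rewrite integral_cst; last exact: measurable_ball.
  rewrite /= [X in _ * X](_ : _ = (r *+ 2)%:E) 1?muleC//.
  exact: lebesgue_measure_ball (ltW r0).
Qed.

End ball_averages.

Section L2_criterion.
Context {R : realType}.
Local Notation leb := (@lebesgue_measure R).
Local Open Scope ereal_scope.
Variable mu : {finite_measure set (measurableTypeR R) -> \bar R}.
Variables (r : R^nat) (K : R).
Hypothesis r_gt0 : forall n, (0 < r n)%R.
Hypothesis r_cvg0 : r @ \oo --> (0 : R)%R.
Hypothesis mu_near : forall n,
  \int[mu]_s mu (ball (s : R) (r n *+ 2)%R) <= (K * (r n *+ 2))%:E.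

(** The ratio of [mu] to Lebesgue measure on a ball, [r n *+ 2] being the length of that ball. *)
Let avg n (t : measurableTypeR R) : \bar R := (r n *+ 2)^-1%:E * mu (ball (t : R) (r n)).

Let avg_ge0 n t : 0 <= avg n t.
Proof. by rewrite mule_ge0// lee_fin invr_ge0 mulrn_wge0// ltW. Qed.

Let measurable_avg n : measurable_fun setT (avg n).
Proof. by apply: measurable_funeM; exact: measurable_measure_ball. Qed.

Let integral_avg_sqr n : \int[leb]_t (avg n t * avg n t) <= K%:E.
Proof.
have c0 : (0 < r n *+ 2)%R by rewrite mulrn_wgt0.
have mb := @measurable_measure_ball R mu (r n).
rewrite (_ : (fun t => _) = (fun t : measurableTypeR R => ((r n *+ 2)^-1 * (r n *+ 2)^-1)%:E *
  (mu (ball (t : R) (r n)) * mu (ball (t : R) (r n))))); last first.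
  by apply/funext => t; rewrite /avg muleACA EFinM.
rewrite ge0_integralZl//.
4: by rewrite lee_fin mulr_ge0// invr_ge0 ltW.
3: by move=> t _; exact: mule_ge0.
2: exact: emeasurable_funM.
apply: (@le_trans _ _ (((r n *+ 2)^-1 * (r n *+ 2)^-1)%:E * ((r n *+ 2)%:E * (K * (r n *+ 2))%:E))).
  apply: lee_wpmul2l; first by rewrite lee_fin mulr_ge0// invr_ge0 ltW.
  apply: le_trans (integral_sqr_measure_ball mu (r_gt0 n)) _.
  by apply: lee_wpmul2l => //; rewrite lee_fin ltW.
rewrite -!EFinM lee_fin.
rewrite [leLHS](_ : _ = K)//; field; exact: lt0r_neq0.
Qed.

Let K_ge0 : (0 <= K)%R.
Proof.
by rewrite -lee_fin; apply: le_trans (integral_avg_sqr 0); apply: integral_ge0 => t _; exact: mule_ge0.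
Qed.

(** The averages [phi n] of the indicator of [U] tend to 1 on [U] because [U] is open, so Fatou
    bounds [mu U] by their integrals, which Tonelli turns into integrals of [avg n] over [U]. The
    parameter [c] stays free, to be balanced for null sets. *)
Let mu_open_le (U : set R) (c : R) : open U -> (0 < c)%R ->
  mu U <= 2^-1%:E * (c%:E * leb U + (c^-1 * K)%:E).
Proof.
move=> oU c0.
have mU : measurable (U : set (measurableTypeR R)) by exact: open_measurable.
pose phi n (s : measurableTypeR R) : \bar R := (r n *+ 2)^-1%:E * leb (U `&` ball (s : R) (r n)).
have mphi n : measurable_fun setT (phi n).
  apply: measurable_funeM.
  have := measurable_fun_ysection leb (measurableI _ _ (measurableX mU measurableT) (@measurable_near_diag R (r n))).
  apply: eq_measurable_fun => s _ /=; congr (leb _).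
  rewrite ysectionE; apply/seteqP; split => x /=.
    by move=> [[Ux _]]; rewrite /near_diag /ball/= distrC.
  by move=> [Ux]; rewrite /near_diag /ball/= distrC.
have phi0 n s : 0 <= phi n s by rewrite mule_ge0// lee_fin invr_ge0 mulrn_wge0// ltW.
have lim1 s : U s -> limn_einf (phi^~ s) = 1.
  move=> Us; suff /cvg_limn_einf_sup[-> //] : phi^~ s @ \oo --> 1.
  have /(nbhs_ballP (s : R))[e /= e0 eU] : nbhs (s : R) U by exact: open_nbhs_nbhs.
  apply: cvg_near_cst; near=> n.
  rewrite /phi (_ : U `&` _ = ball (s : R) (r n)); last first.
    apply/setIidPr => x sx; apply: eU; apply: le_ball sx; apply/ltW.
    have : (`|0 - r n| < e)%R by near: n; move/cvgrPdist_lt : r_cvg0; exact.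
    by rewrite sub0r normrN gtr0_norm.
  have -> := @lebesgue_measure_ball R s (r n) (ltW (r_gt0 n)).
  by rewrite -EFinM mulVf// lt0r_neq0// mulrn_wgt0.
have -> : mu U = \int[mu]_(s in U) limn_einf (phi^~ s).
  rewrite -[LHS]mul1e -integral_cst//; apply: eq_integral => s; rewrite inE => Us.
  by rewrite lim1.
apply: le_trans (fatou _ _ _ _) _ => //.
  by move=> n; exact: measurable_funTS.
apply: limn_einf_le_near; near=> n.
apply: (@le_trans _ _ (\int[mu]_s phi n s)).
  by apply: ge0_subset_integral.
have c'0 : 0 <= ((r n *+ 2)^-1)%:E :> \bar R by rewrite lee_fin invr_ge0 mulrn_wge0// ltW.
have mind : measurable_fun setT (fun t : measurableTypeR R => (\1_U t)%:E : \bar R).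
  by apply/measurable_EFinP; exact: measurable_indic.
have -> : \int[mu]_s phi n s = \int[leb]_t ((\1_U t)%:E * avg n t).
  transitivity ((r n *+ 2)^-1%:E * \int[mu]_s leb (U `&` ball (s : R) (r n))).
    rewrite -ge0_integralZl//.
    have /measurable_funeM : measurable_fun setT (phi n) by [].
    move=> /(_ (r n *+ 2)%:E); apply: eq_measurable_fun => s _.
    by rewrite /phi muleA -EFinM divff ?mul1e// lt0r_neq0// mulrn_wgt0.
  transitivity ((r n *+ 2)^-1%:E * \int[leb]_t ((\1_U t)%:E * mu (ball (t : R) (r n)))).
    congr (_ * _); rewrite integral_near_diag//.
    apply: eq_integral => s _; rewrite integral_indic//; exact: measurable_ball.
  rewrite -ge0_integralZl//.
  - by apply: eq_integral => t _; rewrite muleCA.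
  - apply: emeasurable_funM => //; exact: measurable_measure_ball.
  - by move=> t _; rewrite mule_ge0// lee_fin.
have msq : measurable_fun setT (fun t => avg n t * avg n t) by exact: emeasurable_funM.
apply: (@le_trans _ _ (\int[leb]_t (2^-1%:E * (c%:E * (\1_U t)%:E + c^-1%:E * (avg n t * avg n t))))).
  apply: ge0_le_integral => //.
  - by move=> t _; rewrite mule_ge0// lee_fin.
  - exact: emeasurable_funM.
  - apply: measurable_funeM; apply: emeasurable_funD; exact: measurable_funeM.
  - move=> t _.
    have : avg n t \is a fin_num.
      rewrite ge0_fin_numE// lte_mul_pinfty// ?lee_fin//.
      by apply: le_lt_trans (fin_num_fun_lty (@fin_num_measure _ _ _ mu)); apply: le_measure; rewrite ?inE//; exact: measurable_ball.
    move=> /fineK <-; set v := fine _.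
    rewrite [leRHS](_ : _ = (2^-1 * (c * \1_U t + c^-1 * (v * v)))%:E)// -EFinM lee_fin.
    have i01 : (\1_U t : R) = 0%R \/ (\1_U t : R) = 1%R.
      by rewrite indicE; case: (_ \in _); [right|left].
    have ci0 : (0 < c^-1)%R by rewrite invr_gt0.
    case: i01 => ->.
      by rewrite mul0r mulr0 add0r mulr_ge0// mulr_ge0 ?sqr_ge0// -?expr2 ?sqr_ge0// ltW.
    (* [2 v <= c + v^2 / c] replaces the Cauchy-Schwarz inequality *)
    have := sqr_ge0 (c - v)%R.
    have : (c^-1 * c = 1)%R by rewrite mulVf// lt0r_neq0.
    move=> cc h; have := mulr_ge0 (ltW ci0) h.
    rewrite (_ : c^-1 * (c - v) ^+ 2 = (c^-1 * c) * (c - v *+ 2) + c^-1 * (v * v))%R; last by ring.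
    rewrite cc; lra.
have msqc : measurable_fun setT (fun t => c^-1%:E * (avg n t * avg n t)) by exact: measurable_funeM.
have mindc : measurable_fun setT (fun t : measurableTypeR R => c%:E * (\1_U t)%:E) by exact: measurable_funeM.
have ci0 : 0 <= c^-1%:E :> \bar R by rewrite lee_fin invr_ge0 ltW.
have cE0 : 0 <= c%:E :> \bar R by rewrite lee_fin ltW.
have sq0 t : 0 <= avg n t * avg n t by exact: mule_ge0.
have sqc0 t : 0 <= c^-1%:E * (avg n t * avg n t) by exact: mule_ge0.
have indc0 (t : measurableTypeR R) : 0 <= c%:E * (\1_U t)%:E by rewrite mule_ge0// lee_fin.
rewrite ge0_integralZl//.
3: by move=> t _; apply: adde_ge0.
2: exact: emeasurable_funD.
apply: lee_wpmul2l; first by rewrite lee_fin invr_ge0.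
rewrite ge0_integralD// !ge0_integralZl//.
rewrite integral_indic// setIT leeD// EFinM lee_wpmul2l//.
Unshelve. all: by end_near. Qed.

Let mu_null (S : set R) : measurable (S : set (measurableTypeR R)) -> leb S = 0 -> mu S = 0.
Proof.
move=> mS S0; apply/eqP; rewrite -measure_le0; apply/lee_addgt0Pr => e e0; rewrite add0e.
(* Both [K / c] and [c * (e / c)] are at most [e], so an open set of length at most [e / c] around
   [S] has mass at most [e]. *)
pose c := ((K + 1) / e)%R.
have K1 : (0 < K + 1)%R by rewrite ltr_wpDl.
have c0 : (0 < c)%R by rewrite divr_gt0.
have ec0 : (0 < e / c)%R by rewrite divr_gt0.
have Sy : leb S < +oo by rewrite S0.
have [U [oU SU USe]] := lebesgue_regularity_outer mS Sy ec0.
have mU : measurable (U : set (measurableTypeR R)) by exact: open_measurable.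
have Ue : leb U <= (e / c)%:E.
  rewrite -(setDUK SU); apply: le_trans (measureU2 _ _ _) _ => //.
    exact: measurableD.
  by rewrite [X in X + _]S0 add0e ltW.
apply: (@le_trans _ _ (mu U)); first by apply: le_measure; rewrite ?inE.
apply: le_trans (mu_open_le oU c0) _.
apply: (@le_trans _ _ (2^-1%:E * (c%:E * (e / c)%:E + (c^-1 * K)%:E))).
  rewrite lee_wpmul2l ?lee_fin ?invr_ge0// leeD2r// lee_wpmul2l// lee_fin ltW//.
rewrite [leLHS](_ : _ = (2^-1 * (c * (e / c) + c^-1 * K))%:E)// lee_fin.
have -> : (c * (e / c) = e)%R by rewrite mulrC divfK// lt0r_neq0.
have : (c^-1 * K <= e)%R.
  rewrite /c invf_div mulrAC ler_pdivrMr// ler_pM2l//; lra.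
lra.
Qed.

Let mu_ac : mu `<< leb.
Proof. by apply/null_content_dominatesP => S mS S0; exact: mu_null. Qed.

(** Absolute continuity lets Radon-Nikodym supply [h]; the averages tend to [h] almost everywhere,
    so Fatou transfers their L^2 bound to [h]. *)
Lemma L2_density_of_near_diag : abs_continuous mu /\ has_L2_density mu.
Proof.
split; first exact: mu_null.
have [f [f0 ffin fint fE]] := radon_nikodym_sigma_finite mu_ac.
pose h (x : measurableTypeR R) := fine (f x).
have fh x : f x = (h x)%:E by rewrite fineK.
have h0 x : (0 <= h x)%R by rewrite fine_ge0.
have mf : measurable_fun setT f by exact: measurable_int fint.
have mh : measurable_fun setT h.
  by apply/measurable_EFinP; apply: eq_measurable_fun mf => x _ /=; rewrite fh.
have lh : locally_integrable setT h.
  apply: open_integrable_locally => //; first exact: openT.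
  by apply: eq_integrable fint => // x _; rewrite fh.
have avgE n t : avg n t = (leb (ball (t : R) (r n)))^-1 * \int[leb]_(y in ball (t : R) (r n)) (h y)%:E.
  rewrite /avg fE; last exact: measurable_ball.
  congr (_ * _); last by apply: eq_integral => y _.
  rewrite [X in X^-1](_ : _ = (r n *+ 2)%:E); last exact: lebesgue_measure_ball (ltW (r_gt0 n)).
  by rewrite inver mulrn_eq0/= gt_eqF.
have shr (x : R) : nicely_shrinking x (fun n => ball x (r n)).
  split; first by move=> n; exact: measurable_ball.
  exists (1%R, fun n => PosNum (r_gt0 n)); split => //= n; first by move=> ?.
  by rewrite mul1e.
have ae_lim : {ae leb, forall t, avg ^~ t @ \oo --> (h t)%:E}.
  have := lebesgue_differentiation lh; apply: (@filterS _ _ (ae_filter_ringOfSetsType leb)) => t ht.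
  have := nice_lebesgue_differentiation shr lh ht.
  by under eq_fun do rewrite -avgE.
exists h; split => //; last first.
  by move=> S mS; rewrite fE//; apply: eq_integral => y _.
apply: (@le_lt_trans _ _ K%:E); last exact: ltry.
have msq n : measurable_fun setT (fun t => avg n t * avg n t) by exact: emeasurable_funM.
rewrite (@ge0_ae_eq_integral _ _ _ leb setT _ (fun t => limn_einf (fun n => avg n t * avg n t)))//.
- apply: le_trans (fatou _ _ _ _) _ => //.
    by move=> n t _; exact: mule_ge0.
  by apply: limn_einf_le_near; near=> n; exact: integral_avg_sqr.
- by apply/measurable_EFinP; exact: measurable_funX.
- exact: measurable_limn_einf.
- by move=> t _; rewrite lee_fin sqr_ge0.
- by move=> t _; apply: limn_einf_ge0 => n; exact: mule_ge0.
- move: ae_lim; apply: (@filterS _ _ (ae_filter_ringOfSetsType leb)) => t ht _.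
  have /cvg_limn_einf_sup[-> _] : (fun n => avg n t * avg n t) @ \oo --> (h t)%:E * (h t)%:E.
    by apply: cvgeM.
  by rewrite -EFinM expr2.
Unshelve. all: by end_near. Qed.

End L2_criterion.

(** * Sublevel sets of a lacunary family *)

Section level_sets.
Context {R : realType}.
Implicit Types (g : R -> R) (s : seq R) (p q u v z eta eps T : R).

(** Rolle: two equal values would enclose an interior critical point. The endpoints may be critical,
    which allows cutting an interval at its critical points. *)
Lemma injective_without_critical g p q :
  (forall x, derivable g x 1) ->
  (forall z, p < z < q -> derive1 g z <> 0) ->
  {in `[p, q] &, injective g}.
Proof.
move=> dg ncrit.
have cg : continuous g by move=> x; apply/differentiable_continuous/derivable1_diffP.
suff H u v : p <= u -> v <= q -> u < v -> g u <> g v.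
  move=> u v; rewrite !in_itv/= => /andP[pu uq] /andP[pv vq] guv.
  by case: (ltgtP u v) => // uv; exfalso; [exact: (H u v)|exact: (H v u)].
move=> pu vq uv guv.
have [c cuv dc] := Rolle uv (fun x _ => dg x) (continuous_subspaceT cg) guv.
move: cuv; rewrite in_itv/= => /andP[uc cv]; apply: (ncrit c).
  by rewrite (le_lt_trans pu uc) (lt_le_trans cv vq).
by rewrite derive1E; exact: derive_val.
Qed.

(** Induction on a list containing the critical points: one that is interior cuts the interval in
    two, and both halves keep the rest of the list. *)
Lemma injective_pieces g p q : (forall x, derivable g x 1) -> p <= q ->
  finite_set (`[p, q] `&` critical_points g) ->
  exists l : seq (R * R),
    (forall u, p <= u <= q -> exists2 c, c \in l & c.1 <= u <= c.2) /\
    (forall c, c \in l -> {in `[c.1, c.2] &, injective g}).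
Proof.
move=> dg pq /finite_seqP[s crit_s].
have : forall z, p < z < q -> derive1 g z = 0 -> z \in s.
  move=> z /andP[pz zq] gz0.
  suff : [set` s] z by [].
  by rewrite -crit_s; split => //=; rewrite in_itv/= !ltW.
elim: s p q pq {crit_s} => [|z s IH] p q pq crit.
  exists [:: (p, q)]; split; first by move=> u upq; exists (p, q); rewrite ?mem_head.
  move=> c; rewrite inE => /eqP -> /=; apply: injective_without_critical => //.
  by move=> z zpq /(crit _ zpq).
have [/andP[pz zq]|zpq] := boolP (p < z < q); last first.
  apply: IH => // y ypq /(crit _ ypq); rewrite inE => /orP[/eqP yz|//].
  by rewrite -yz ypq in zpq.
have [|l1 [l1c l1i]] := IH p z (ltW pz).
  move=> y /andP[py yz] y0; have := crit y; rewrite py (lt_trans yz zq) inE lt_eqF//=; exact.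
have [|l2 [l2c l2i]] := IH z q (ltW zq).
  move=> y /andP[zy yq] y0; have := crit y; rewrite yq (lt_trans pz zy) inE gt_eqF//=; exact.
exists (l1 ++ l2); split.
  move=> u /andP[pu uq]; have [uz|zu] := leP u z.
    by have [|c cl cu] := l1c u; rewrite ?pu//; exists c; rewrite // mem_cat cl.
  by have [|c cl cu] := l2c u; rewrite ?(ltW zu)//; exists c; rewrite // mem_cat cl orbT.
by move=> c; rewrite mem_cat => /orP[/l1i|/l2i].
Qed.

(** By injectivity the continuous function [|g (u + eta) - g u|] has a positive minimum on
    [[p, q - eta]]; the monotonicity of an injective continuous function carries the bound to every
    [v] beyond [u + eta]. *)
Lemma injective_separation g p q eta : continuous g -> {in `[p, q] &, injective g} ->
  0 < eta -> exists2 eps, 0 < eps & forall u v, u \in `[p, q] -> v \in `[p, q] ->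
    eta <= `|u - v| -> eps <= `|g u - g v|.
Proof.
move=> cg ginj eta0.
suff [eps eps0 H] : exists2 eps, 0 < eps & forall u v, u \in `[p, q] -> v \in `[p, q] ->
    u + eta <= v -> eps <= `|g u - g v|.
  exists eps => // u v uI vI; have [uv|vu] := leP u v.
    by rewrite distrC ger0_norm ?subr_ge0// => uve; apply: H => //; lra.
  rewrite ger0_norm; last by rewrite subr_ge0 ltW.
  by move=> uve; rewrite distrC; apply: H => //; lra.
have [pq|qp] := leP p (q - eta); last first.
  (* An interval shorter than [eta] contains no such pair, so any [eps] will do. *)
  exists 1 => // u v; rewrite !in_itv/= => /andP[pu uq] /andP[pv vq] uv; exfalso; lra.
have cphi : continuous (fun u => `|g (u + eta) - g u|).
  move=> u; apply: cvg_norm; apply: cvgB; last exact: cg.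
  by apply: (@continuous_comp _ _ _ (fun u => u + eta) g); [apply: cvgD; [exact: cvg_id|exact: cvg_cst]|exact: cg].
have [c cI cmin] := EVT_min pq (continuous_subspaceT cphi).
move: cI; rewrite in_itv/= => /andP[pc cq].
have cgI : {within [set` `[p, q]], continuous g} by exact: continuous_subspaceT.
exists `|g (c + eta) - g c|.
  rewrite normr_gt0 subr_eq0; apply/eqP => /ginj; rewrite !in_itv/=.
  move=> H; have E : c + eta = c by apply: H; apply/andP; split; lra.
  by lra.
move=> u v uI vI uv; move: (uI) (vI); rewrite !in_itv/= => /andP[pu uq] /andP[pv vq].
have /cmin/le_trans -> // : u \in `[p, q - eta] by rewrite in_itv/= pu/=; lra.
have ueI : u + eta \in `[p, q] by rewrite in_itv/=; apply/andP; split; lra.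
have uue : u < u + eta by lra.
move: uv; rewrite le_eqVlt => /orP[/eqP ->|uv]; first by rewrite distrC.
case: (itv_continuous_inj_mono cgI ginj) => mono.
  have m1 := mono _ _ uI ueI uue; have m2 := mono _ _ ueI vI uv.
  rewrite gtr0_norm ?subr_gt0// ltr0_norm; lra.
have m1 := mono _ _ ueI uI uue; have m2 := mono _ _ vI ueI uv.
rewrite ltr0_norm ?subr_lt0// gtr0_norm; lra.
Qed.

Lemma periodic_int g T (m : int) u : periodic g T -> g (u + T * m%:~R) = g u.
Proof.
move=> pg; case: m => n; first by rewrite -pmulrn mulr_natr periodicn.
by rewrite NegzE mulrNz mulrN -pmulrn mulr_natr -[in RHS](subrK (T *+ n.+1) u) periodicn.
Qed.

(* The number [M] of balls does not depend on their radius: it counts the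
   monotone pieces of [g] over two periods. *)
Lemma sublevel_cover g T : 0 < T -> periodic g T -> (forall x, derivable g x 1) ->
  locally_finitely_many_critical g ->
  exists M : nat, forall eta, 0 < eta -> exists2 eps, 0 < eps &
    forall (c : R) p, exists2 s, (size s <= M)%N &
      forall u, p <= u <= p + T -> `|g u - c| < eps -> exists2 z, z \in s & `|u - z| < eta.
Proof.
move=> T0 pg dg crit.
have cg : continuous g by move=> x; apply/differentiable_continuous/derivable1_diffP.
(* Any window [[p, p + T]] has a translate by a multiple of [T] inside two periods. *)
have TT : 0 <= T *+ 2 by rewrite mulrn_wge0// ltW.
have [l [lc li]] := injective_pieces dg TT (crit 0 (T *+ 2)).
exists (size l) => eta eta0.
have [eps eps0 sep] : exists2 eps, 0 < eps & forall b, b \in l -> forall u v,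
    u \in `[b.1, b.2] -> v \in `[b.1, b.2] -> eta <= `|u - v| -> eps <= `|g u - g v|.
  elim: l {lc} li => [|b l IH] li; first by exists 1.
  have [|e1 e10 H1] := IH; first by move=> c cl; apply: li; rewrite inE cl orbT.
  have bi := li b (mem_head _ _).
  have [e2 e20 H2] := injective_separation cg bi eta0.
  exists (Num.min e1 e2); first by rewrite lt_min e10.
  move=> c; rewrite inE => /orP[/eqP ->|cl] u v uc vc uv; rewrite ge_min.
    by rewrite (H2 _ _ uc vc uv) orbT.
  by rewrite (H1 _ cl _ _ uc vc uv).
(* Values within [eps / 2] of [c] are less than [eps] apart, so two such points of one piece are
   closer than [eta]. *)
exists (eps / 2); first by rewrite divr_gt0.
move=> c p; pose m := Num.floor (p / T).
(* One centre per piece: a point of the sublevel set in it, or the default 0 if there is none. *)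
have /choice[z hz] : forall b : R * R, exists z, b \in l ->
    forall u, u \in `[b.1, b.2] -> `|g u - c| < eps / 2 -> `|u - z| < eta.
  move=> b; have [[u0 [u0b gu0]]|no] := pselect (exists u, u \in `[b.1, b.2] /\ `|g u - c| < eps / 2).
    exists u0 => bl u ub gu; rewrite ltNge; apply/negP => /= /(sep _ bl _ _ ub u0b).
    apply/negP; rewrite -ltNge; apply: le_lt_trans (ler_distD c _ _) _.
    by rewrite (distrC c); lra.
  by exists 0 => _ u ub gu; exfalso; apply: no; exists u.
exists [seq z b + T * m%:~R | b <- l]; first by rewrite size_map.
move=> u /andP[pu upT] gu.
have /andP[m1 m2] := floor_itv (p / T).
rewrite -/m ler_pdivlMr// mulrC in m1; rewrite -/m intrD ltr_pdivrMr// mulrDl mul1r mulrC in m2.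
have [|b bl bu] := lc (u - T * m%:~R).
  by apply/andP; split; rewrite ?mulr2n; lra.
exists (z b + T * m%:~R); first exact: map_f.
have -> : u - (z b + T * m%:~R) = u - T * m%:~R - z b by ring.
apply: hz => //.
by rewrite -(periodic_int m _ pg) subrK.
Qed.

End level_sets.

(** * Covers by balls of equal radius *)

Section covers.
Context {R : realType}.
Implicit Types (S : set R) (s : seq R) (x z : R).

Definition ball_covered S s (rho : R) :=
  forall x, S x -> exists2 z, z \in s & `|x - z| <= rho.

(** The interval of length [2 r] is covered by adjacent cells of length [2 rho], whose midpoints are
    the centres. *)
Lemma ball_cover (z r rho : R) : 0 <= r -> 0 < rho ->
  exists2 s, (size s <= (Num.truncn (r / rho)).+1)%N & ball_covered [set x | `|x - z| < r] s rho.
Proof.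
move=> r0 rho0; pose K := (Num.truncn (r / rho)).+1.
have q0 : 0 <= r / rho by rewrite divr_ge0// ltW.
have /andP[K1 K2] := truncn_itv q0.
exists [seq z - r + rho + (rho *+ 2) * i%:R | i <- iota 0 K].
  by rewrite size_map size_iota.
move=> x xr; have {xr} : `|x - z| < r by []; rewrite ltr_distl => /andP[x1 x2].
pose w := (x - z + r) / (rho *+ 2).
have rr0 : 0 < rho *+ 2 by rewrite mulrn_wgt0.
have w0 : 0 <= w by rewrite divr_ge0 ?ltW//; lra.
have /andP[] := truncn_itv w0; set i := Num.truncn w => i1 i2.
exists (z - r + rho + (rho *+ 2) * i%:R).
  apply/mapP; exists i => //; rewrite mem_iota leq0n add0n -(ltr_nat R); apply: le_lt_trans i1 _.
  apply: le_lt_trans K2; rewrite ler_pdivrMr//.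
  have : r / rho * rho = r by rewrite divfK// gt_eqF.
  by rewrite mulrnAr => ->; rewrite mulr2n; lra.
rewrite ler_pdivlMr// in i1; rewrite ltr_pdivrMr// -natr1 mulrDl mul1r in i2.
rewrite mulrC in i1; rewrite mulrC in i2.
by rewrite ler_distl; apply/andP; split; move: i1 i2; rewrite mulr2n; lra.
Qed.

Lemma ball_covered_refine S s rho rho' N :
  (forall z, exists2 t, (size t <= N)%N & ball_covered (S `&` [set x | `|x - z| <= rho]) t rho') ->
  ball_covered S s rho ->
  exists2 t, (size t <= size s * N)%N & ball_covered S t rho'.
Proof.
move=> H; have /choice[t tP] : forall z, exists t, (size t <= N)%N /\
    ball_covered (S `&` [set x | `|x - z| <= rho]) t rho'.
  by move=> z; have [t tN tc] := H z; exists t.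
move=> sc; exists (flatten [seq t z | z <- s]).
  elim: s {sc} => //= z s IH; rewrite size_cat mulSn; apply: leq_add => //; exact: (tP z).1.
move=> x Sx; have [z zs xz] := sc _ Sx; have [w wt xw] := (tP z).2 x (conj Sx xz).
by exists w => //; apply/flattenP; exists (t z) => //; exact: map_f.
Qed.

Lemma ball_covered_measure S s (rho : R) : 0 <= rho -> measurable S -> ball_covered S s rho ->
  (lebesgue_measure S <= ((size s)%:R * (rho *+ 2))%:E)%E.
Proof.
move=> rho0; elim: s S => [|z s IH] S mS sc.
  rewrite (_ : S = set0); first by rewrite measure0 mul0r.
  by apply/seteqP; split => x // /sc[].
have mB : measurable (`[z - rho, z + rho]%classic : set (measurableTypeR R)) by exact: measurable_itv.
rewrite -(setUIDK S `[z - rho, z + rho]%classic).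
apply: le_trans (measureU2 _ _ _) _; [exact: measurableI|exact: measurableD|].
rewrite /= -natr1 mulrDl mul1r addrC EFinD; apply: leeD.
  apply: IH; first exact: measurableD.
  move=> x [Sx] /=; rewrite in_itv/= => /negP xz; have [w] := sc _ Sx.
  rewrite inE => /orP[/eqP ->|ws xw]; last by exists w.
  by move=> h; rewrite -ler_distl h in xz.
apply: (@le_trans _ _ (lebesgue_measure `[z - rho, z + rho]%classic)).
    by apply: le_measure; rewrite ?inE//; exact: measurableI.
  rewrite lebesgue_measure_itv/= lte_fin; case: ifPn => _; rewrite lee_fin ?mulrn_wge0//.
  by rewrite mulr2n; lra.
Qed.

End covers.

(** * Points whose values stay close to given ones at many scales *)

Lemma measurable_multiscale {R : realType} (g : R -> R) (beta th c : nat -> R) eps J :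
  continuous g ->
  measurable ([set x | forall j, (j < J)%N -> `|g (beta j * x + th j) - c j| < eps] : set (measurableTypeR R)).
Proof.
move=> cg.
rewrite (_ : [set x | _] =
    \bigcap_(j in `I_J) [set x | `|g (beta j * x + th j) - c j| < eps])//.
apply: bigcap_measurableType => j _; apply: open_measurable.
pose phi x := `|g (beta j * x + th j) - c j|.
have cphi : continuous phi.
  move=> x; apply: cvg_norm; apply: cvgB; last exact: cvg_cst.
  apply: (@continuous_comp _ _ _ (fun x => beta j * x + th j) g); last exact: cg.
  by apply: cvgD; [apply: cvgM; [exact: cvg_cst|exact: cvg_id]|exact: cvg_cst].
rewrite (_ : [set x | _] = phi @^-1` [set y | y < eps]) //.
by apply: open_comp; [move=> x _; exact: cphi|exact: open_lt].
Qed.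

Section multiscale.
Context {R : realType}.
Variables (g : R -> R) (T : R).
Implicit Types (x y z : R).
Hypotheses (T0 : 0 < T) (pg : periodic g T) (dg : forall x, derivable g x 1)
  (crit : locally_finitely_many_critical g).

(** Induction on [J]. A ball of the cover at scale [J] has radius [T / (2 |beta J|)], so
    [x -> beta J * x + th J] maps it onto one period of [g]. There the sublevel set lies in a
    bounded number of small balls, which are pulled back and covered again at scale [J + 1]. As [M]
    is fixed before [B], [B] can later be taken large against it. *)
Lemma multiscale_cover : exists2 M : nat, (0 < M)%N & forall B : R, 0 < B -> exists2 eps, 0 < eps &
  forall beta th : nat -> R, (forall j, beta j != 0) ->
    (forall j, B * `|beta j| <= `|beta j.+1|) ->
  exists C : R, forall (c : nat -> R) J, exists2 s,
    (size s)%:R * (T / (2 * `|beta J|)) <= C * (2 * M%:R / B) ^+ J &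
    ball_covered [set x | 0 <= x <= T /\
      forall j, (j < J)%N -> `|g (beta j * x + th j) - c j| < eps] s (T / (2 * `|beta J|)).
Proof.
have [M HM] := sublevel_cover T0 pg dg crit.
(* With this [eta] the pulled-back balls have radius [rho J / B], which is at least [rho J.+1]. The
   successor makes the constant positive. *)
exists M.+1 => // B B0; pose eta := T / (2 * B).
have eta0 : 0 < eta by rewrite divr_gt0// mulr_gt0.
have [eps eps0 Heps] := HM eta eta0; exists eps => // beta th beta0 betaB.
pose rho J := T / (2 * `|beta J|).
have rho0 J : 0 < rho J by rewrite divr_gt0// mulr_gt0// normr_gt0.
have rhoS J : rho J.+1 <= rho J / B.
  rewrite /rho -mulrA ler_pM2l// -invfM lef_pV2 ?posrE ?mulr_gt0// ?normr_gt0//.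
  by rewrite -mulrA ler_pM2l// mulrC.
(* The constant is the total radius at [J = 0], where [[0, T]] is covered as part of the ball of
   radius [2 T] about 0. *)
exists ((Num.truncn (T *+ 2 / rho 0%N)).+1%:R * rho 0%N) => c; elim=> [|J [s sJ sc]].
  have [s s1 s2] := ball_cover 0 (mulrn_wge0 2 (ltW T0)) (rho0 0%N).
  exists s; first by rewrite expr0 mulr1; apply: ler_wpM2r; [exact: ltW (rho0 0%N) | rewrite ler_nat].
  move=> x [/andP[x0 xT] _]; apply: s2 => /=; rewrite subr0 ger0_norm//.
  by rewrite mulr2n (le_lt_trans xT)// ltrDl.
pose K := (Num.truncn (eta / `|beta J| / rho J.+1)).+1.
have b0 : 0 < `|beta J| by rewrite normr_gt0.
have etab0 : 0 <= eta / `|beta J| by rewrite divr_ge0// ltW.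
(* Rounding up costs one more ball, whose radius [rho J.+1] is at most [rho J / B]; this is the
   source of the 2 in the ratio. *)
have Kle : K%:R * rho J.+1 <= 2 * (rho J / B).
  have /andP[h _] := truncn_itv (divr_ge0 etab0 (ltW (rho0 J.+1))).
  move: h; rewrite ler_pdivlMr// /K -natr1 mulrDl mul1r.
  have -> : eta / `|beta J| = rho J / B.
    by rewrite /eta /rho; field; rewrite !gt_eqF.
  by have := rhoS J; lra.
have [t tN tc] : exists2 t, (size t <= size s * (M * K))%N &
    ball_covered [set x | 0 <= x <= T /\
      forall j, (j < J.+1)%N -> `|g (beta j * x + th j) - c j| < eps] t (rho J.+1).
  apply: (@ball_covered_refine _ _ _ (rho J)); last first.
    by move=> x [xT xj]; apply: sc; split => // j jJ; apply: xj; exact: ltnW.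
  (* The window of length [T] centred at the image of [z] contains the image of the ball of radius
     [rho J] about [z]. *)
  move=> z; have [w wM wc] := Heps (c J) (beta J * z + th J - T / 2).
  pose w' := [seq (y - th J) / beta J | y <- w].
  suff [t tN tc] : exists2 t, (size t <= size w * K)%N &
      ball_covered [set x | exists2 y, y \in w' & `|x - y| < eta / `|beta J| ] t (rho J.+1).
    exists t; first by apply: leq_trans tN _; rewrite leq_mul2r wM orbT.
    move=> x [[_ xj] /= xz]; apply: tc => /=.
    have [| |y yw uy] := wc (beta J * x + th J).
    - have : `|beta J * (x - z)| <= T / 2.
        rewrite normrM -ler_pdivlMl//; apply: le_trans xz _.
        by rewrite /rho invfM [leRHS]mulrC -mulrA.
      rewrite ler_norml => /andP[h1 h2]; move: h1 h2; rewrite mulrBr => h1 h2.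
      by apply/andP; split; lra.
    - exact: xj.
    exists ((y - th J) / beta J); first exact: map_f.
    rewrite ltr_pdivlMr// -normrM mulrBl divfK//.
    by rewrite mulrC opprB addrA.
  rewrite -(size_map (fun y => (y - th J) / beta J)) -/w'.
  elim: w' => [|y w'' [t tN tc]]; first by exists [::] => // x [].
  have [t' t'N t'c] := ball_cover y etab0 (rho0 J.+1).
  exists (t' ++ t).
    rewrite size_cat mulSn leq_add//.
  move=> x [y']; rewrite inE => /orP[/eqP -> xy|yw xy].
    by have [v vt xv] := t'c _ xy; exists v; rewrite // mem_cat vt.
  have [|v vt xv] := tc x; first by exists y'.
  by exists v; rewrite // mem_cat vt orbT.
exists t => //.
rewrite -/(rho J.+1); apply: (@le_trans _ _ ((size s * (M * K))%:R * rho J.+1)).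
  by rewrite ler_wpM2r ?ler_nat// ltW.
have -> : (size s * (M * K))%:R * rho J.+1 = (size s)%:R * (M%:R * (K%:R * rho J.+1)).
  by rewrite !natrM; ring.
rewrite exprS.
apply: (@le_trans _ _ ((size s)%:R * (M.+1%:R * (2 * (rho J / B))))).
  rewrite ler_wpM2l//; apply: ler_pM => //; first by rewrite mulr_ge0// ltW.
  by rewrite ler_nat.
have := sJ; rewrite -/(rho J) => h.
rewrite [leLHS](_ : _ = (2 * M.+1%:R / B) * ((size s)%:R * rho J)); last by field; rewrite gt_eqF.
rewrite [leRHS](_ : _ = (2 * M.+1%:R / B) * ((Num.truncn (T *+ 2 / rho 0%N)).+1%:R * rho 0%N * (2 * M.+1%:R / B) ^+ J)); last by ring.
by rewrite ler_wpM2l// divr_ge0// ?ltW// mulr_ge0.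
Qed.

Lemma multiscale_measure : exists2 M : nat, (0 < M)%N & forall B : R, 0 < B -> exists2 eps, 0 < eps &
  forall beta th : nat -> R, (forall j, beta j != 0) ->
    (forall j, B * `|beta j| <= `|beta j.+1|) ->
  exists2 C : R, 0 <= C & forall (c : nat -> R) J,
    (lebesgue_measure ([set x : R | forall j, (j < J)%N ->
      (`|g (beta j * x + th j) - c j| < eps)%R] `&` `[0%R, T]) <= (C * (2 * M%:R / B) ^+ J)%:E)%E.
Proof.
have [M M0 HM] := multiscale_cover; exists M => // B B0.
have [eps eps0 Heps] := HM B B0; exists eps => // beta th beta0 betaB.
have [C HC] := Heps beta th beta0 betaB.
have rho0 J : 0 < T / (2 * `|beta J|) by rewrite divr_gt0// mulr_gt0// normr_gt0.
(* The cover controls total radii; lengths are twice as large. *)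
exists (C *+ 2).
  have [s sC _] := HC (fun=> 0) 0%N; rewrite mulrn_wge0//.
  by rewrite expr0 mulr1 in sC; apply: le_trans sC; rewrite mulr_ge0// ltW.
move=> c J; have [s sC scov] := HC c J.
have cg : continuous g by move=> x; apply/differentiable_continuous/derivable1_diffP.
apply: le_trans (ball_covered_measure (ltW (rho0 J)) _ _) _.
- by apply: measurableI; [exact: measurable_multiscale|exact: measurable_itv].
- by move=> x [xJ]; rewrite /= in_itv => xT; apply: scov.
rewrite lee_fin; apply: (@le_trans _ _ (((size s)%:R * (T / (2 * `|beta J|))) *+ 2)).
  by rewrite !mulr2n mulrDr.
rewrite [leRHS](_ : _ = (C * (2 * M%:R / B) ^+ J) *+ 2); last by rewrite !mulr2n mulrDl.
by rewrite lerMn2r.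
Qed.

End multiscale.

(** * Small balls and the expected near-diagonal mass *)

Section small_ball.
Context {R : realType} d (Omega : measurableType d) (P : probability Omega R).
Local Notation leb := (@lebesgue_measure R).
Variables (X : nat -> Omega -> R) (s : nat -> R).
Hypotheses (mX : forall n, measurable_fun setT (X n))
  (Xs : forall n w, `|X n w| <= s n) (s_gt0 : forall n, 0 < s n)
  (indep : mutually_independent P X)
  (dens : forall n (B : set R), measurable B ->
    (P (X n @^-1` B) <= ((2 * s n)^-1)%:E * leb B)%E).
Variable G : nat -> R.

(** A cylinder event: finitely many coordinates are constrained, and [upd] will add a constraint on
    a fresh one. *)
Let evt (I : {fset nat}) (B : nat -> set R) := \bigcap_(i in [set` I]) (X i @^-1` B i).

Let mXB n (B : set R) : measurable B -> measurable (X n @^-1` B).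
Proof. by move=> mB; rewrite -[X in measurable X]setTI; exact: mX. Qed.

Let mevt I B : (forall i, measurable (B i)) -> measurable (evt I B).
Proof.
move=> mB; apply: fin_bigcap_measurable; first exact: finite_fset.
by move=> i _; exact: mXB.
Qed.

Let upd (B : nat -> set R) n C i := if i == n then C else B i.

Let evtU1 (I : {fset nat}) (B : nat -> set R) n C : n \notin I ->
  evt (n |` I)%fset (upd B n C) = evt I B `&` X n @^-1` C.
Proof.
move=> nI; apply/seteqP; split => w.
  move=> H; split; last first.
    have := H n; rewrite /upd eqxx; apply; by rewrite /= !inE eqxx.
  move=> i iI; have := H i; rewrite /upd; case: eqP => [ni|_].
    by move: iI; rewrite ni /= => nI'; rewrite nI' in nI.
  by apply; rewrite /= !inE iI orbT.
move=> [H1 H2] i; rewrite /= !inE /upd; case: eqP => [->|ni /=]; first by [].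
by move=> iI; exact: H1.
Qed.

Let PevtU1 (I : {fset nat}) (B : nat -> set R) n C : n \notin I ->
  (forall i, measurable (B i)) -> measurable C ->
  P (evt I B `&` X n @^-1` C) = (P (evt I B) * P (X n @^-1` C))%E.
Proof.
move=> nI mB mC; rewrite -evtU1// /evt indep; last first.
  by move=> i; rewrite /upd; case: ifP.
rewrite big_fsetU1//= /upd eqxx muleC; congr (_ * _)%E.
rewrite indep//; apply: eq_big_seq => i iI; case: eqP => // ni.
by rewrite ni (negbTE nI) in iI.
Qed.

(* Conditioning is replaced by cutting the range of the remaining variables into
   cells of length [h] and using the product rule on each cell. *)
Let small_ball_cells n h (I : {fset nat}) B (l : seq nat) c r :
  G n != 0 -> 0 < h -> 0 <= r ->
  (forall i, measurable (B i)) -> uniq l -> n \notin l -> n \notin I ->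
  (forall i, i \in l -> i \notin I) ->
  (P (evt I B `&` [set w | (`|X n w * G n + c + \sum_(m <- l) X m w * G m| < r)%R]) <=
   P (evt I B) * ((r + h * \sum_(m <- l) `|G m|) / (s n * `|G n|))%:E)%E.
Proof.
move=> Gn0 h0; elim: l I B c r => [|m l IH] I B c r r0 mB.
  move=> _ _ nI _; rewrite big_nil mulr0 addr0.
  have Gn : 0 < `|G n| by rewrite normr_gt0.
  (* With no other variable left, the event confines [X n] to a ball, and the density bound
     applies. *)
  pose C := ball (- c / G n) (r / `|G n|).
  rewrite (_ : [set w | _] = X n @^-1` C); last first.
    have E w : `|X n w * G n + c| = `|(- c / G n - X n w) * G n|.
      by rewrite -normrN; congr (`|_|); field.
    by apply/seteqP; split => w; rewrite /C /ball/= big_nil addr0 ltr_pdivlMr// -normrM E.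
  rewrite PevtU1//; last exact: measurable_ball.
  apply: lee_wpmul2l => //; apply: le_trans (dens n _) _; first exact: measurable_ball.
  have r1 : 0 <= r / `|G n| by rewrite divr_ge0// ltW.
  rewrite [X in (_ * X)%E](_ : _ = ((r / `|G n|) *+ 2)%:E); last exact: lebesgue_measure_ball.
  rewrite -EFinM lee_fin.
  rewrite [leLHS](_ : _ = r / (s n * `|G n|))//; field.
  by rewrite !gt_eqF.
move=> /= /andP[ml ul]; rewrite inE negb_or => /andP[nm nl] nI lI.
(* [K] half-open cells of length [h] starting at [- s m] cover the range of [X m], the endpoint
   [s m] included. *)
pose K := (Num.truncn ((2 * s m) / h)).+1.
pose C j := `[- s m + h * j%:R, - s m + h * j.+1%:R[%classic : set R.
have mC j : measurable (C j) by exact: measurable_itv.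
have mI : m \notin I by apply: lI; rewrite mem_head.
(* On the cell [C j], [X m] is replaced by the left endpoint; the error is at most [h |G m|] and is
   added to the radius. *)
pose F j := evt (m |` I)%fset (upd B m (C j)) `&`
  [set w | (`|X n w * G n + (c + (- s m + h * j%:R) * G m) + \sum_(k <- l) X k w * G k| < r + h * `|G m|)%R].
have mB' j : forall i, measurable (upd B m (C j) i) by move=> i; rewrite /upd; case: ifP.
have mF j : measurable (F j).
  apply: measurableI; first exact: mevt.
  rewrite -[X in measurable X]setTI; apply: measurable_fun_ltr => //.
  apply: measurableT_comp => //; apply: measurable_funD.
    by apply: measurable_funD => //; exact: measurable_funM.
  by apply: measurable_sum => k; exact: measurable_funM.
have mlhs : measurable (evt I B `&` [set w | (`|X n w * G n + c + \sum_(k <- m :: l) X k w * G k| < r)%R]).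
  apply: measurableI; first exact: mevt.
  rewrite -[X in measurable X]setTI; apply: measurable_fun_ltr => //.
  apply: measurableT_comp => //; apply: measurable_funD.
    by apply: measurable_funD => //; exact: measurable_funM.
  by apply: measurable_sum => k; exact: measurable_funM.
have cellP w : exists2 j, (j < K)%N & X m w \in C j.
  have /ler_normlP[x1 x2] := Xs m w.
  have w0 : 0 <= (X m w + s m) / h by apply: divr_ge0; [lra|exact: ltW].
  have /andP[i1 i2] := truncn_itv w0.
  exists (Num.truncn ((X m w + s m) / h)).
    rewrite ltnS; apply: le_truncn; rewrite ler_pM2r ?invr_gt0//; lra.
  rewrite ler_pdivlMr// in i1; rewrite ltr_pdivrMr// in i2.
  rewrite inE /C /= in_itv/=; apply/andP; split; first by rewrite mulrC; lra.
  by rewrite mulrC; lra.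
have sub : evt I B `&` [set w | (`|X n w * G n + c + \sum_(k <- m :: l) X k w * G k| < r)%R]
    `<=` \big[setU/set0]_(j < K) F j.
  move=> w [Ew]; rewrite /= big_cons => Hw; have [j jK] := cellP w.
  rewrite inE => wC; rewrite -bigcup_mkord; exists j => //.
  split; first by rewrite evtU1.
  move: wC; rewrite /C /= in_itv/= -natr1 mulrDr mulr1 => /andP[w1 w2].
  have e : `|X m w - (- s m + h * j%:R)| <= h.
    by rewrite ger0_norm; lra.
  rewrite /= (_ : X n w * G n + _ + _ = (X n w * G n + c + (X m w * G m + \sum_(k <- l) X k w * G k))
    - (X m w - (- s m + h * j%:R)) * G m); last by ring.
  apply: le_lt_trans (ler_normB _ _) _; apply: ltr_leD => //.
  by rewrite normrM ler_wpM2r.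
apply: le_trans (_ : (P (\big[setU/set0]_(j < K) F j) <= _)%E).
  by apply: le_measure; rewrite ?inE//; exact: bigsetU_measurable.
apply: le_trans (Boole_inequality P (fun i _ => mF i)) _.
set q := ((r + _) / _)%R.
have q0 : 0 <= q.
  rewrite /q divr_ge0//; last by rewrite mulr_ge0// ltW.
  by rewrite addr_ge0// mulr_ge0 ?sumr_ge0// ltW.
apply: (@le_trans _ _ (\sum_(j < K) (P (evt I B) * P (X m @^-1` (C j)) * q%:E))%E).
  apply: lee_sum => j _; rewrite /F.
  apply: le_trans (IH _ _ _ _ _ _ ul nl _ _) _ => //.
  - by rewrite addr_ge0// mulr_ge0// ltW.
  - by rewrite !inE negb_or nm.
  - move=> i il; rewrite !inE negb_or lI ?inE ?il ?orbT// andbT.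
    by apply: contraNneq ml => <-.
  - by rewrite evtU1// PevtU1// /q big_cons mulrDr addrA.
rewrite -ge0_sume_distrl; last by move=> j _; exact: mule_ge0.
apply: lee_wpmul2r; first by rewrite lee_fin.
rewrite -ge0_sume_distrr// -[leRHS]mule1; apply: lee_wpmul2l => //.
(* The cells are disjoint, so their probabilities add up to at most 1. *)
rewrite -(@measure_semi_additive_ord_I _ _ _ P (fun j => X m @^-1` C j) K).
- by apply: probability_le1; apply: bigsetU_measurable => j _; exact: mXB.
- by move=> j _; exact: mXB.
- move=> i j _ _ [w []]; rewrite /C /= !in_itv/= => /andP[a1 a2] /andP[b1 b2].
  have H1 : (i < j.+1)%N by rewrite -(ltr_nat R) -(ltr_pM2l h0); lra.
  have H2 : (j < i.+1)%N by rewrite -(ltr_nat R) -(ltr_pM2l h0); lra.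
  by apply/eqP; rewrite eqn_leq -ltnS H1 -ltnS H2.
- by apply: bigsetU_measurable => j _; exact: mXB.
Qed.

Lemma small_ball N n r : (n < N)%N -> G n != 0 -> 0 < r ->
  (P [set w | (`|\sum_(0 <= m < N) X m w * G m| < r)%R] <= ((2 * r) / (s n * `|G n|))%:E)%E.
Proof.
move=> nN Gn0 r0; pose l := rem n (index_iota 0 N).
have nl : n \in index_iota 0 N by rewrite mem_index_iota.
have S0 : 0 <= \sum_(m <- l) `|G m| by exact: sumr_ge0.
(* The mesh is so fine that all the cell errors together are at most [r], whence [2 r] in the bound;
   [1 +] keeps the denominator positive. *)
pose h := r / (1 + \sum_(m <- l) `|G m|).
have h0 : 0 < h by rewrite divr_gt0// ltr_wpDr.
have := @small_ball_cells n h fset0 (fun=> setT) l 0 r Gn0 h0 (ltW r0) (fun=> measurableT)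
  (rem_uniq _ (iota_uniq _ _)).
rewrite mem_rem_uniqF ?iota_uniq// => /(_ erefl erefl (fun _ _ => erefl)).
rewrite /evt set_fset0 bigcap_set0 setTI probability_setT mul1e.
have E w : \sum_(0 <= m < N) X m w * G m = X n w * G n + 0 + \sum_(m <- l) X m w * G m.
  by rewrite addr0 (big_rem n).
rewrite (_ : [set w | (`|\sum_(0 <= m < N) X m w * G m| < r)%R] =
  [set w | (`|X n w * G n + 0 + \sum_(m <- l) X m w * G m| < r)%R]); last first.
  by apply/seteqP; split => w /=; rewrite E.
move=> /le_trans; apply; rewrite lee_fin ler_wpM2r ?invr_ge0 ?mulr_ge0 ?(ltW (s_gt0 _))//.
have : h * \sum_(m <- l) `|G m| <= r.
  by rewrite /h mulrAC ler_pdivrMr ?ltr_wpDr// ler_pM2l//; lra.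
lra.
Qed.

End small_ball.

(** * The occupation measure as a push-forward *)

Section interval_measure.
Context {R : realType} (T : R).
Local Notation leb := (@lebesgue_measure R).
Local Open Scope ereal_scope.

Lemma lebesgue_measure_itv_lty : leb `[0%R, T] < +oo.
Proof. by rewrite lebesgue_measure_itv/=; case: ifP => _; rewrite ltry. Qed.

Definition itv_measure : {finite_measure set (measurableTypeR R) -> \bar R} :=
  mfrestr (measurable_itv `[0%R, T] : measurable (`[0%R, T]%classic : set (measurableTypeR R)))
    lebesgue_measure_itv_lty.

(** The occupation measure is the push-forward of [itv_measure] under [f], so a change of variables
    turns its near-diagonal mass into the measure of the pairs with close values. *)
Lemma occupation_near_diag (f : measurableTypeR R -> measurableTypeR R) (r : R^nat) (K : R) :
  measurable_fun setT f -> (forall n, (0 < r n)%R) -> r @ \oo --> (0 : R)%R ->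
  (forall n, \int[itv_measure]_x itv_measure [set y | (`|f x - f y| < r n *+ 2)%R] <= (K * (r n *+ 2))%:E) ->
  abs_continuous (occupation f T) /\ has_L2_density (occupation f T).
Proof.
move=> mf r0 rcvg Hnear.
pose mu0 : {measure set (measurableTypeR R) -> \bar R} :=
  @measure_function_pushforward__canonical__measure_function_Measure _ _ _ _ R itv_measure f mf.
have mu0T : mu0 setT < +oo by exact: (fin_num_fun_lty (@fin_num_measure _ _ _ itv_measure)).
(* Restricting to the whole space leaves the push-forward unchanged and packages it as a finite
   measure. *)
pose mu : {finite_measure set (measurableTypeR R) -> \bar R} := mfrestr measurableT mu0T.
have muE S : mu S = occupation f T S.
  by rewrite /mu /= /mfrestr /mrestr setIT /occupation setIC.
have mu0E A : mu A = mu0 A by rewrite /mu /= /mfrestr /mrestr setIT.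
have [|ac L2] := @L2_density_of_near_diag R mu r K r0 rcvg.
  move=> n; rewrite (eq_measure_integral mu0); last by move=> A _ _; exact: mu0E.
  rewrite ge0_integral_pushforward//; last exact: measurable_measure_ball.
  apply: le_trans (Hnear n); rewrite preimage_setT le_eqVlt; apply/orP; left; apply/eqP.
  by apply: eq_integral => x _; rewrite /= mu0E.
split; first by move=> S mS S0; rewrite -muE; exact: ac.
by have [h [mh h0 hy hE]] := L2; exists h; split => // S mS; rewrite -muE hE.
Qed.

End interval_measure.

(** * Limits of small-ball bounds and summation over exit times *)

Section first_exit.
Context {R : realType}.

Lemma periodic_bounded (g : R -> R) T : 0 < T -> periodic g T -> continuous g ->
  exists2 Gm, 0 <= Gm & forall x, `|g x| <= Gm.
Proof.
move=> T0 pg cg.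
have cn : continuous (fun x => `|g x|) by move=> x; apply: cvg_norm; exact: cg.
have [c _ cmax] := EVT_max (ltW T0) (continuous_subspaceT cn).
exists `|g c| => // x; pose m := Num.floor (x / T).
have /andP[m1 m2] := floor_itv (x / T).
rewrite -/m ler_pdivlMr// mulrC in m1; rewrite -/m intrD ltr_pdivrMr// mulrDl mul1r mulrC in m2.
rewrite -[x](subrK (T * m%:~R)) (periodic_int m _ pg); apply: cmax.
by rewrite in_itv/=; apply/andP; split; lra.
Qed.

Lemma sum_geometric_le (x : R) J : 0 <= x < 1 -> \sum_(j < J) x ^+ j <= (1 - x)^-1.
Proof.
move=> /andP[x0 x1]; have x1' : 0 < 1 - x by rewrite subr_gt0.
rewrite -[leRHS]mul1r ler_pdivlMr// mulrC.
have := subrX1 x J; rewrite -[x - 1]opprB mulNr => /eqP.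
rewrite -eqr_oppLR opprB => /eqP <-.
by rewrite lerBlDr lerDl exprn_ge0.
Qed.

(** The strict inequality is an open condition, so the indicator for [Z] is at most the lower limit
    of those for [Z_ N], and Fatou applies. The bound is asked for [N > n] because it will come from
    the term of index [n] of a partial sum. *)
Lemma probability_lt_lim d (Omega : measurableType d) (P : probability Omega R)
    (Z_ : nat -> Omega -> R) (Z : Omega -> R) (r : R) (c : \bar R) n :
  (forall N, measurable_fun setT (Z_ N)) -> measurable_fun setT Z ->
  (forall w, Z_ ^~ w @ \oo --> Z w) ->
  (forall N, (n < N)%N -> (P [set w | (`|Z_ N w| < r)%R] <= c)%E) ->
  (P [set w | (`|Z w| < r)%R] <= c)%E.
Proof.
move=> mZ_ mZ Zcvg Pc.
have mlt (Y : Omega -> R) : measurable_fun setT Y -> measurable [set w | `|Y w| < r].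
  move=> mY; rewrite -[X in measurable X]setTI; apply: measurable_fun_ltr => //.
  exact: measurableT_comp.
pose u N w := (\1_[set w | `|Z_ N w| < r] w)%:E : \bar R.
have mu N : measurable_fun setT (u N) by apply/measurable_EFinP; exact: measurable_indic (mlt _ (mZ_ N)).
have u0 N w : (0 <= u N w)%E by rewrite lee_fin.
rewrite -[X in P X]setIT -integral_indic//; last exact: mlt.
apply: (@le_trans _ _ (\int[P]_w limn_einf (u ^~ w))%E).
  apply: ge0_le_integral => //.
  - by apply/measurable_EFinP; exact: measurable_indic (mlt _ mZ).
  - exact: measurable_limn_einf.
  move=> w _; rewrite indicE; case: (boolP (w \in _)) => [|_]; last exact: limn_einf_ge0.
  rewrite inE /= => Zr; suff /cvg_limn_einf_sup[-> //] : u ^~ w @ \oo --> 1%E.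
  have near_r : \forall N \near \oo, `|Z_ N w| < r by exact: cvgr_lt (cvg_norm (Zcvg w)) _ Zr.
  by apply: cvg_near_cst; apply: filterS near_r => N HN; rewrite /u indicE mem_set.
apply: le_trans (fatou _ _ _ _) _ => //.
apply: limn_einf_le_near; exists n.+1 => // N /= nN.
by rewrite integral_indic ?setIT//; [exact: Pc|exact: mlt].
Qed.

(* If [p] is large at [x] then [x] lies in a long initial run of the [E j];
   summing over the first exit time gives a geometric series. *)
Lemma integral_first_exit d (Y : measurableType d) (m : {finite_measure set Y -> \bar R})
    (p : Y -> \bar R) (E : nat -> set Y) (C q A alpha : R) :
  measurable_fun setT p -> (forall x, 0 <= p x)%E -> (forall x, p x <= 1)%E ->
  (forall j, measurable (E j)) ->
  0 <= C -> 0 <= q -> 0 <= A -> 1 <= alpha -> alpha * q < 1 ->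
  (forall j x, ~ E j x -> (p x <= (A * alpha ^+ j)%:E)%E) ->
  (forall J, (m (\bigcap_(j in `I_J) E j) <= (C * q ^+ J)%:E)%E) ->
  (\int[m]_x p x <= (A * C / (1 - alpha * q))%:E)%E.
Proof.
move=> mp p0 p1 mE C0 q0 A0 alpha1 aq pE mEC.
pose F J := \bigcap_(j in `I_J) E j.
have alpha0 : 0 <= alpha by exact: le_trans alpha1.
have mF J : measurable (F J) by apply: bigcap_measurableType.
have i0 J x : (0 <= (\1_(F J) x)%:E :> \bar R)%E by rewrite lee_fin.
have mi J : measurable_fun setT (fun x => (\1_(F J) x)%:E : \bar R).
  by apply/measurable_EFinP; exact: measurable_indic.
have c0 j : (0 <= (A * alpha ^+ j)%:E :> \bar R)%E by rewrite lee_fin mulr_ge0// exprn_ge0.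
(* Stop after [J] scales: the points that have not left contribute at most [C q^J], since [p <= 1];
   this tends to 0 because [q <= alpha * q < 1]. *)
have bound J : (\int[m]_x p x <= (A * C / (1 - alpha * q) + C * q ^+ J)%:E)%E.
  apply: (@le_trans _ _ (\int[m]_x ((\sum_(j < J) (A * alpha ^+ j)%:E * (\1_(F j) x)%:E) + (\1_(F J) x)%:E))%E).
    apply: ge0_le_integral => //.
      apply: emeasurable_funD => //; apply: emeasurable_sum => j.
      exact: measurable_funeM.
    move=> x _; have s0 K : (0 <= \sum_(j < K) (A * alpha ^+ j)%:E * (\1_(F j) x)%:E :> \bar R)%E.
      by apply: sume_ge0 => j _; exact: mule_ge0.
    have [xF|xF] := pselect (F J x).
      have -> : \1_(F J) x = 1 :> R by rewrite indicE mem_set.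
      by rewrite (le_trans (p1 x))// leeDr.
    apply: (@le_trans _ _ (\sum_(j < J) (A * alpha ^+ j)%:E * (\1_(F j) x)%:E)%E); last by rewrite leeDl.
    have [j jJ [nE xj]] : exists2 j, (j < J)%N & ~ E j x /\ F j x.
      elim: J xF => [|J IH] xF; first by exfalso; apply: xF.
      have [xFJ|xFJ] := pselect (F J x); last by have [j jJ H] := IH xFJ; exists j => //; exact: ltnW.
      exists J => //; split=> // EJ; apply: xF => j /=; rewrite ltnS leq_eqVlt => /orP[/eqP ->//|].
      exact: xFJ.
    rewrite (bigD1 (Ordinal jJ))//= indicE mem_set// mule1.
    rewrite (le_trans (pE _ _ nE))// leeDl// sume_ge0// => k _; exact: mule_ge0.
  rewrite ge0_integralD//; last 2 first.
    by move=> x _; apply: sume_ge0 => j _; exact: mule_ge0.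
    by apply: emeasurable_sum => j; exact: measurable_funeM.
  rewrite EFinD; apply: leeD; last by rewrite integral_indic// setIT; exact: mEC.
  rewrite ge0_integral_sum//; last 2 first.
    by move=> j; exact: measurable_funeM.
    by move=> j x _; exact: mule_ge0.
  apply: (@le_trans _ _ (\sum_(j < J) (A * C * (alpha * q) ^+ j)%:E)%E).
    apply: lee_sum => j _; rewrite ge0_integralZl// integral_indic// setIT.
    apply: le_trans (lee_wpmul2l (c0 j) (mEC j)) _.
    by rewrite -EFinM lee_fin exprMn mulrACA.
  rewrite sumEFin lee_fin -mulr_sumr ler_wpM2l ?mulr_ge0//.
  by apply: sum_geometric_le; rewrite aq mulr_ge0.
apply/lee_addgt0Pr => e e0.
have q1 : `|q| < 1.
  by rewrite ger0_norm// (le_lt_trans _ aq)// ler_peMl.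
have : (fun J => C * q ^+ J) @ \oo --> C * 0.
  by apply: cvgM; [exact: cvg_cst|exact: cvg_expr].
rewrite mulr0 => /cvgr_lt /(_ _ e0) [J _ /(_ J (leqnn J)) HJ].
by apply: le_trans (bound J) _; rewrite -EFinD lee_fin lerD2l ltW.
Qed.

End first_exit.

(** * The random series and its expected near-diagonal mass *)

Section random_series.
Context {R : realType} d (Omega : measurableType d) (P : probability Omega R).
Variables (X : nat -> Omega -> R) (a : R) (g : R -> R) (T : R) (bn th : nat -> R).
Hypotheses (a01 : 0 < a < 1) (mX : forall n, measurable_fun setT (X n))
  (Xa : forall n w, `|X n w| <= a ^+ n)
  (indep : mutually_independent P X)
  (dens : forall n (B : set R), measurable B ->
    (P (X n @^-1` B) <= ((2 * a ^+ n)^-1)%:E * lebesgue_measure B)%E).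
Hypotheses (T0 : 0 < T) (pg : periodic g T) (dg : forall x, derivable g x 1)
  (crit : locally_finitely_many_critical g).

Let cg : continuous g.
Proof. by move=> x; apply/differentiable_continuous/derivable1_diffP. Qed.

Let f := random_series X g bn th.

Let a_gt0 : 0 < a. Proof. by case/andP: a01. Qed.

Let psum N w x := \sum_(0 <= n < N) X n w * g (bn n * x + th n).

(** Boundedness of [g] and [|X n w| <= a^n] give a geometric majorant at every sample point, so the
    [limn] in [random_series] is a true limit. *)
Lemma random_series_cvg w x : (fun N => psum N w x) @ \oo --> f w x.
Proof.
have [Gm Gm0 gG] := periodic_bounded T0 pg cg.
have [_ a1] := andP a01.
suff : cvgn (series (fun n => X n w * g (bn n * x + th n))) by [].
apply: normed_cvg; apply: (series_le_cvg (v_ := geometric Gm a)) => //.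
- by move=> n /=.
- by move=> n; rewrite mulr_ge0// exprn_ge0// ltW.
- by move=> n; rewrite /= normrM mulrC ler_pM.
- by apply: is_cvg_geometric_series; rewrite ger0_norm// ltW.
Qed.

Lemma measurable_random_series :
  measurable_fun setT (fun p : Omega * measurableTypeR R => f p.1 p.2).
Proof.
apply: (measurable_fun_cvg (h := fun N p => psum N p.1 p.2)) => [N|p _]; last exact: random_series_cvg.
apply: measurable_sum => n; apply: measurable_funM; first exact: measurableT_comp.
apply: measurableT_comp; first exact: continuous_measurable_fun.
by apply: measurable_funD => //; apply: measurable_funM.
Qed.

Let measurable_f x : measurable_fun setT (f ^~ x).
Proof. exact: (measurableT_comp measurable_random_series (measurable_fun_pair _ _)). Qed.

(** For fixed [x] and [y] the difference is a random series with coefficients [G m]; the bound for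
    partial sums containing the term [n] passes to the limit. *)
Lemma random_series_small_ball x y n r : 0 < r ->
  g (bn n * x + th n) != g (bn n * y + th n) ->
  (P [set w | (`|f w x - f w y| < r)%R] <=
   ((2 * r) / (a ^+ n * `|g (bn n * x + th n) - g (bn n * y + th n)|))%:E)%E.
Proof.
move=> r0 gxy; pose G m := g (bn m * x + th m) - g (bn m * y + th m).
apply: (@probability_lt_lim _ _ _ P (fun N w => \sum_(0 <= m < N) X m w * G m)
  (fun w => f w x - f w y) r _ n).
- by move=> N; apply: measurable_sum => m; exact: measurable_funM.
- exact: measurable_funB.
- move=> w; rewrite (_ : (fun N => _) = (fun N => psum N w x - psum N w y)).
    by apply: cvgB; exact: random_series_cvg.
  by apply/funext => N; rewrite /psum -sumrB; apply: eq_bigr => k _; rewrite -mulrBr.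
- move=> N nN; apply: small_ball => //; last by rewrite subr_eq0.
  by move=> m; exact: exprn_gt0.
Qed.

(** The nesting makes the section at [(w, x)] a set of [y], which is measured first. *)
Let near_pairs (r : R) := [set z : (Omega * measurableTypeR R) * measurableTypeR R |
  `|f z.1.1 z.1.2 - f z.1.1 z.2| < r].

Let measurable_near_pairs r : measurable (near_pairs r).
Proof.
rewrite -[near_pairs r]setTI; apply: measurable_fun_ltr => //.
apply: measurableT_comp => //; apply: measurable_funB.
- by apply: (measurableT_comp measurable_random_series (g := fst)).
- apply: (measurableT_comp measurable_random_series (g := fun z => (z.1.1, z.2))).
  by apply: measurable_fun_pair => //; exact: measurableT_comp.
Qed.

(** With [x] frozen, Tonelli can exchange [w] and [y]. *)
Let near_pairs_at (r : R) x := [set z : Omega * measurableTypeR R |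
  `|f z.1 x - f z.1 z.2| < r].

Let measurable_near_pairs_at r x : measurable (near_pairs_at r x).
Proof.
rewrite -[near_pairs_at r x]setTI; apply: measurable_fun_ltr => //.
apply: measurableT_comp => //; apply: measurable_funB.
- exact: (measurableT_comp (measurable_f x)).
- exact: measurable_random_series.
Qed.

Local Notation m := (itv_measure T).

(** The near-diagonal mass of the occupation measure of [f w], expressed on pairs of points of
    [[0, T]]. *)
Let D (r : R) w := (\int[m]_x m [set y | (`|f w x - f w y| < r)%R])%E.

Let H (r : R) (z : Omega * measurableTypeR R) : \bar R := m (xsection (near_pairs r) z).

Let measurable_H r : measurable_fun setT (H r).
Proof. exact: (measurable_fun_xsection m (measurable_near_pairs r)). Qed.

Let H_ge0 r z : (0 <= H r z)%E. Proof. exact: measure_ge0. Qed.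

Let DE r w : D r w = (\int[m]_x H r (w, x))%E.
Proof. by apply: eq_integral => x _; rewrite /H xsectionE. Qed.

Let measurable_D r : measurable_fun setT (D r).
Proof.
rewrite (_ : D r = fubini_F m (H r)); last by apply/funext => w; rewrite DE.
exact: measurable_fun_fubini_tonelli_F.
Qed.

Let D_ge0 r w : (0 <= D r w)%E. Proof. exact: integral_ge0. Qed.

Let expect_D r : (\int[P]_w D r w = \int[m]_x \int[P]_w H r (w, x))%E.
Proof. by under eq_integral do rewrite DE; rewrite (fubini_tonelli (m1 := P) (m2 := m) (H r)). Qed.

Let expect_H r x : (\int[P]_w H r (w, x) =
  \int[m]_y P [set w | (`|f w x - f w y| < r)%R])%E.
Proof.
have mnp := measurable_near_pairs_at r x.
have := indic_fubini_tonelli P m mnp.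
rewrite indic_fubini_tonelli_FE// indic_fubini_tonelli_GE// => E.
transitivity (\int[P]_w (m \o xsection (near_pairs_at r x)) w)%E.
  by apply: eq_integral => w _; rewrite /H /= !xsectionE.
by rewrite E; apply: eq_integral => y _; rewrite /= ysectionE.
Qed.

Let measurable_Pxy (r : R) x :
  measurable_fun setT (fun y : measurableTypeR R => P [set w | (`|f w x - f w y| < r)%R]).
Proof.
apply: eq_measurable_fun (measurable_fun_ysection P (measurable_near_pairs_at r x)).
by move=> y _; rewrite /= ysectionE.
Qed.

Section lacunary.
Variable b : R.
Hypotheses (b_gt1 : 1 < b) (bn_ratio : forall n : nat, (0 < n)%N -> b <= bn n.+1 / bn n)
  (ab_gt1 : 1 < a * b).

(** A zero denominator makes the quotient 0, which the ratio bound at index [n.+1] excludes. That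
    bound does not reach index 0, so the scales used below start at 1. *)
Let bn_neq0 n : bn n.+1 != 0.
Proof.
apply/eqP => bn0; have := @bn_ratio n.+1 isT.
by rewrite bn0 invr0 mulr0 leNgt (lt_trans _ b_gt1).
Qed.

Let bn_growth k n : b ^+ k * `|bn n.+1| <= `|bn (n + k).+1|.
Proof.
elim: k => [|k IH]; first by rewrite expr0 mul1r addn0.
rewrite exprS -mulrA addnS; have b0 : 0 <= b by rewrite ltW// (lt_trans _ b_gt1).
apply: le_trans (ler_wpM2l b0 IH) _.
rewrite -ler_pdivlMr ?normr_gt0// -normfV -normrM.
exact: le_trans (@bn_ratio (n + k).+1 isT) (ler_norm _).
Qed.

(** Tonelli reduces the estimate to a fixed [x]; then the first scale that separates [y] from [x]
    decides which small-ball bound is used. *)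
Let expect_D_le : exists2 C : R, 0 <= C & forall r, 0 < r -> (\int[P]_w D r w <= (C * r)%:E)%E.
Proof.
have b0 : 0 < b by rewrite (lt_trans _ b_gt1).
have [M M0 HM] := multiscale_measure T0 pg dg crit.
(* As [M] does not depend on [B], one may take [B = b ^ k]; since [a b > 1], a large [k] makes
   [b ^ k] outweigh both [2 M] and the loss [a ^ k] in the density. *)
have [k kM] : exists k, 2 * M%:R < (a * b) ^+ k.
  have ab0 : `|(a * b)^-1| < 1.
    by rewrite ger0_norm ?invr_ge0 ?mulr_ge0 ?ltW// invf_lt1// mulr_gt0.
  have e0 : 0 < (2 * M%:R)^-1 :> R by rewrite invr_gt0 mulr_gt0// ltr0n.
  have [k _ /(_ k (leqnn k))] := cvgr_lt _ (cvg_expr ab0) _ e0.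
  rewrite /= exprVn ltf_pV2 ?posrE ?exprn_gt0 ?mulr_gt0 ?ltr0n// => Hk.
  by exists k.
have bk0 : 0 < b ^+ k by exact: exprn_gt0.
have [eps eps0 Heps] := HM _ bk0.
pose beta j := bn (k * j).+1; pose tht j := th (k * j).+1.
have [|C C0 HC] := Heps beta tht (fun j => bn_neq0 _).
  by move=> j; rewrite /beta mulnS addnC; exact: bn_growth.
(* Per step of [k] scales, [q] bounds the decay of the length of the unseparated set and [alpha] is
   the growth of the small-ball bound. *)
pose q := 2 * M%:R / b ^+ k; pose alpha := (a ^+ k)^-1.
have ak0 : 0 < a ^+ k by exact: exprn_gt0.
have q0 : 0 <= q by apply: divr_ge0; [rewrite mulr_ge0// ler0n|exact: ltW].
have alpha1 : 1 <= alpha.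
  by rewrite invf_ge1// exprn_ile1// ltW//; case/andP: a01.
have aq : alpha * q < 1.
  rewrite (_ : alpha * q = 2 * M%:R / (a * b) ^+ k).
    by rewrite ltr_pdivrMr ?mul1r// exprn_gt0// mulr_gt0.
  by rewrite /alpha /q exprMn; field; rewrite !gt_eqF.
have ae0 : 0 < a * eps by rewrite mulr_gt0.
pose K := 2 / (a * eps) * C / (1 - alpha * q).
have K0 : 0 <= K.
  apply: divr_ge0; last by rewrite subr_ge0 ltW.
  by rewrite mulr_ge0// divr_ge0// ltW.
have inner x r : 0 < r -> (\int[P]_w H r (w, x) <= (K * r)%:E)%E.
  move=> r0; rewrite expect_H; pose c j := g (beta j * x + tht j).
  (* The points not separated from [x] at scale [k j + 1]. Off [E j] the small-ball bound is
     [2 r / (a^(k j + 1) eps)], whence the [a] next to [eps] in the constants. *)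
  pose E j := [set y : measurableTypeR R | `|g (beta j * y + tht j) - c j| < eps].
  have mE j : measurable (E j).
    have := measurable_multiscale (fun=> beta j) (fun=> tht j) (fun=> c j) eps 1 cg.
    by congr (measurable _); apply/seteqP; split => y; [move=> /(_ 0%N isT)|move=> Ey i _].
  have mP y : measurable [set w | `|f w x - f w y| < r].
    rewrite -[X in measurable X]setTI; apply: measurable_fun_ltr => //.
    by apply: measurableT_comp => //; exact: measurable_funB.
  have A0 : 0 <= 2 * r / (a * eps) by rewrite divr_ge0 ?(ltW ae0)// mulr_ge0// ltW.
  have P1 y : (P [set w | (`|f w x - f w y| < r)%R] <= 1)%E by exact: probability_le1.
  have PE j y : ~ E j y ->
      (P [set w | (`|f w x - f w y| < r)%R] <= (2 * r / (a * eps) * alpha ^+ j)%:E)%E.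
    move=> /negP; rewrite -leNgt => Gy.
    have Gxy : eps <= `|g (beta j * x + tht j) - g (beta j * y + tht j)| by rewrite distrC.
    apply: le_trans (@random_series_small_ball x y (k * j).+1 r r0 _) _.
      by rewrite -subr_eq0 -normr_gt0 (lt_le_trans eps0 Gxy).
    rewrite lee_fin (_ : 2 * r / (a * eps) * alpha ^+ j = 2 * r / (a * eps * (a ^+ k) ^+ j)); last first.
      by rewrite /alpha exprVn (invfM (a * eps)) mulrA.
    rewrite ler_pM2l ?mulr_gt0// lef_pV2 ?posrE ?mulr_gt0 ?exprn_gt0//.
      by rewrite exprS exprM mulrAC ler_wpM2l// mulr_ge0 ?exprn_ge0 ?ltW.
    exact: lt_le_trans Gxy.
  apply: le_trans (integral_first_exit (m := m) (measurable_Pxy r x) (fun y => measure_ge0 P _) P1 mE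
    C0 q0 A0 alpha1 aq PE (HC c)) _.
  by rewrite lee_fin /K le_eqVlt; apply/orP; left; apply/eqP; ring.
exists (K * fine (m setT)).
  by rewrite mulr_ge0// fine_ge0.
move=> r r0; rewrite expect_D.
apply: (@le_trans _ _ (\int[m]_x (cst (K * r)%:E) x)%E).
  apply: ge0_le_integral => //.
  - by move=> x _; exact: integral_ge0.
  - exact: (measurable_fun_fubini_tonelli_G (m1 := P) (H r)).
  - by move=> x _; exact: inner.
rewrite integral_cst// -[X in (_ * X)%E]fineK ?fin_num_measure//.
by rewrite -EFinM lee_fin mulrAC.
Qed.

Lemma random_series_ae_density : {ae P, forall w,
  abs_continuous (occupation (f w) T) /\ has_L2_density (occupation (f w) T)}.
Proof.
have [C C0 HC] := expect_D_le.
pose r n : R := n.+1%:R^-1.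
have r0 n : 0 < r n by rewrite invr_gt0.
have rr0 n : 0 < r n *+ 2 by rewrite mulrn_wgt0.
(* The expectations of these ratios are at most [C], so by Fatou their lower limit is integrable,
   hence finite almost surely. *)
pose phi n w : \bar R := (((r n *+ 2)^-1)%:E * D (r n *+ 2)%R w)%E.
have c0 n : (0 <= ((r n *+ 2)^-1)%:E :> \bar R)%E by rewrite lee_fin invr_ge0 ltW.
have phi0 n w : (0 <= phi n w)%E by exact: mule_ge0.
have mphi n : measurable_fun setT (phi n) by exact: measurable_funeM.
have intL : (\int[P]_w limn_einf (phi ^~ w) <= C%:E)%E.
  apply: le_trans (fatou _ _ _ _) _ => //.
  apply: limn_einf_le_near; apply: nearW => n.
  rewrite ge0_integralZl//; apply: le_trans (lee_wpmul2l (c0 n) (HC _ (rr0 n))) _.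
  by rewrite -EFinM lee_fin mulrCA mulVf ?mulr1// gt_eqF.
have L0 w : (0 <= limn_einf (phi ^~ w))%E by exact: limn_einf_ge0.
have iL : P.-integrable setT (fun w => limn_einf (phi ^~ w)).
  apply/integrableP; split; first exact: measurable_limn_einf.
  under eq_integral do rewrite gee0_abs//.
  by apply: le_lt_trans intL _; rewrite ltry.
have := integrable_ae measurableT iL; apply: filterS => w /(_ I) Lfin.
(* Infinitely many ratios lie below a number exceeding the lower limit; [sigma] picks one from each
   [N] on, so the chosen radii still tend to 0. *)
pose K := fine (limn_einf (phi ^~ w)) + 1.
have /choice[sigma Hsigma] : forall N, exists n, (N <= n)%N /\ (phi n w < K%:E)%E.
  move=> N; have : (einfs (phi ^~ w) N < K%:E)%E.
    apply: (@le_lt_trans _ _ (limn_einf (phi ^~ w))).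
      rewrite limn_einf_lim; apply: lime_ge; first exact: is_cvg_einfs.
      by exists N => // n /= Nn; exact: nondecreasing_einfs.
    by rewrite -(fineK Lfin) lte_fin ltrDl.
  by move=> /ereal_inf_lt[_ /= [n Nn <-] H1]; exists n.
apply: (@occupation_near_diag R T (f w) (r \o sigma) K).
- exact: (measurableT_comp measurable_random_series (measurable_fun_pair _ _)).
- by move=> n; exact: r0.
- have : (r : R^nat) @ \oo --> (0 : R) by exact: cvg_harmonic.
  move=> /cvgrPdist_lt rcvg; apply/cvgrPdist_lt => e /rcvg[N _ HN]; exists N => // n /= Nn.
  by apply: HN => /=; apply: leq_trans Nn (Hsigma n).1.
- move=> n; have [_ /ltW] := Hsigma n; rewrite /phi => H1.
  have := lee_wpmul2l (ltW (rr0 (sigma n)) : (0 <= (r (sigma n) *+ 2)%:E)%E) H1.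
  rewrite muleA -EFinM divff ?gt_eqF// mul1e -EFinM mulrC; exact.
Qed.

End lacunary.

End random_series.

(** * Truncation of the uniform variables *)

Section truncation.
Context {R : realType} d (Omega : measurableType d) (P : probability Omega R).
Variables (A : nat -> Omega -> R) (s : nat -> R).
Hypotheses (mA : forall n, measurable_fun setT (A n)) (s_gt0 : forall n, 0 < s n)
  (indep : mutually_independent P A) (unif : forall n, uniform_sym P (A n) (s n)).

Let clip n (t : measurableTypeR R) : R := if `|t| < s n then t else 0.

Let measurable_clip n : measurable_fun setT (clip n).
Proof.
by apply: measurable_fun_ifT => //; apply: measurable_fun_ltr => //.
Qed.

Let mclip n B : measurable B -> measurable (clip n @^-1` B).
Proof. by move=> mB; rewrite -[X in measurable X]setTI; exact: measurable_clip. Qed.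

(* The uniform variables are bounded only almost surely; truncation makes the
   random series converge at every sample point. *)
Definition truncated n w := clip n (A n w).

Lemma measurable_truncated n : measurable_fun setT (truncated n).
Proof. exact: (measurableT_comp (measurable_clip n) (mA n)). Qed.

Lemma truncated_le n w : `|truncated n w| <= s n.
Proof. by rewrite /truncated /clip; case: ifPn => [/ltW//|_]; rewrite normr0 ltW. Qed.

(** Truncation acts on each coordinate by a Borel map, so the product rule is an instance of the
    original one. *)
Lemma truncated_independent : mutually_independent P truncated.
Proof.
move=> I B mB; have := indep I (fun i => mclip i (mB i)).
by [].
Qed.

(** On [(- s n, s n)] the truncation is the identity, and the uniform law has no mass elsewhere, so
    the default value 0 creates no atom. *)
Lemma truncated_density n (B : set R) : measurable B ->
  (P (truncated n @^-1` B) <= ((2 * s n)^-1)%:E * lebesgue_measure B)%E.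
Proof.
move=> mB; rewrite (_ : truncated n @^-1` B = A n @^-1` (clip n @^-1` B))//.
rewrite (unif n (mclip n mB)).
apply: lee_wpmul2l; first by rewrite lee_fin invr_ge0 mulr_ge0// ltW.
have mI : measurable ([set x : measurableTypeR R | - s n < x < s n] : set (measurableTypeR R)).
  by rewrite (_ : [set x | _] = `](- s n), s n[%classic); [exact: measurable_itv|apply/seteqP; split => x; rewrite /= in_itv].
apply: le_measure; rewrite ?inE//; first by apply: measurableI => //; exact: mclip.
move=> x [Bx /= xs]; move: Bx; rewrite /clip /=.
by rewrite ltr_norml xs.
Qed.

Lemma truncated_ae : {ae P, forall w, forall n, truncated n w = A n w}.
Proof.
apply: ae_foralln => n.
pose C := ~` [set x : measurableTypeR R | - s n < x < s n].
have mC : measurable C.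
  apply: measurableC; rewrite (_ : [set x | _] = `](- s n), s n[%classic); first exact: measurable_itv.
  by apply/seteqP; split => x; rewrite /= in_itv.
exists (A n @^-1` C); split.
- by rewrite -[X in measurable X]setTI; exact: mA.
- have PC : P (A n @^-1` C) = 0%E by rewrite (unif n mC) setICl measure0 mule0.
  exact: PC.
- move=> w /= H Aw; apply: H; rewrite /truncated /clip ltr_norml.
  by have -> : - s n < A n w < s n.
Qed.

End truncation.

(** * Reduction of both cases to [a b > 1] *)

Theorem theoremB (R : realType) (g : R -> R) (T : R)
    (d : measure_display) (Omega : measurableType d)
    (P : probability Omega R) (A : nat -> {RV P >-> R}) (a : R) :
  0 < T -> periodic g T -> C1 g -> locally_finitely_many_critical g ->
  0 < a < 1 ->
  mutually_independent P (fun n => (A n : Omega -> R)) ->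
  (forall n, uniform_sym P (A n) (a ^+ n)) ->
  (* general case *)
  (forall (bn : nat -> R) (b : R) (th : nat -> R),
     1 < b -> (forall n : nat, (0 < n)%N -> b <= bn n.+1 / bn n) ->
     1 < a ^+ 2 * b ->
     {ae P, forall w,
        abs_continuous (occupation (random_series (fun n => A n : Omega -> R) g bn th w) T) /\
        has_L2_density (occupation (random_series (fun n => A n : Omega -> R) g bn th w) T)}) /\
  (* lacunary integer case b_n = b^n, theta_n = 0 *)
  (forall b : nat, (1 < b)%N -> 1 < a * b%:R ->
     {ae P, forall w,
        abs_continuous (occupation (random_series (fun n => A n : Omega -> R) g
                                     (fun n => b%:R ^+ n) (fun=> 0) w) T) /\
        has_L2_density (occupation (random_series (fun n => A n : Omega -> R) g
                                     (fun n => b%:R ^+ n) (fun=> 0) w) T)}).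
Proof.
move=> T0 pg [dg _] crit a01 indep unif.
have [a0 a1] := andP a01.
have s0 n : 0 < a ^+ n by exact: exprn_gt0.
have mA n : measurable_fun setT (A n : Omega -> R) by exact: measurable_funP.
suff main (bn : nat -> R) (b : R) (th : nat -> R) : 1 < b ->
    (forall n : nat, (0 < n)%N -> b <= bn n.+1 / bn n) -> 1 < a * b ->
    {ae P, forall w,
      abs_continuous (occupation (random_series (fun n => A n : Omega -> R) g bn th w) T) /\
      has_L2_density (occupation (random_series (fun n => A n : Omega -> R) g bn th w) T)}.
  split=> [bn b th b1 bnb ab|b b1 ab].
    apply: (main bn b th) => //; apply: lt_le_trans ab _.
    by rewrite expr2 -mulrA ler_piMl ?ltW// mulr_gt0// (lt_trans _ b1).
  apply: (main _ b%:R) => // [|n _]; first by rewrite ltr1n.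
  by rewrite exprS mulfK// expf_neq0// pnatr_eq0 -lt0n (ltn_trans _ b1).
move=> b1 bnb ab.
pose X := truncated (fun n => A n : Omega -> R) (fun n => a ^+ n).
have mX n : measurable_fun setT (X n) by exact: measurable_truncated.
have Xa n w : `|X n w| <= a ^+ n by exact: truncated_le.
have Xindep : mutually_independent P X by exact: truncated_independent.
have Xdens n (B : set R) : measurable B ->
    (P (X n @^-1` B) <= ((2 * a ^+ n)^-1)%:E * lebesgue_measure B)%E.
  by move=> mB; exact: truncated_density.
have XA : {ae P, forall w, forall n, X n w = A n w} by exact: truncated_ae.
have := random_series_ae_density th a01 mX Xa Xindep Xdens T0 pg dg crit b1 bnb ab.
(* On the almost sure event where truncation changes no coefficient, the two series coincide. *)
apply: filterS2 XA => w wA.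
rewrite (_ : random_series X g bn th w = random_series (fun n => A n : Omega -> R) g bn th w)//.
rewrite /random_series; apply/funext => x; congr (limn _); apply/funext => N.
by apply: eq_bigr => n _; rewrite wA.
Qed.
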